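(* Let $X$ and $Z$ be Hausdorff, locally convex topological vector spaces, let $C\subseteq Z$ be a convex, pointed cone, and let $K$ be a nonempty, convex and compact subset of $X$. Let $D\subseteq K$ be a self segment-dense set in $K$ and consider a mapping $F:K\to L(X,Z)$ satisfying (i) for all $y\in D$, the mapping $x\mapsto\langle F(y),y-x\rangle$ is strongly $C$-upper semicontinuous on $K$; (ii) for all $x\in K$, the mapping $y\mapsto\langle F(y),y-x\rangle$ is strongly $C$-upper semicontinuous on $K\setminus D$; (iii) for all $x\in D$, the mapping $y\mapsto\langle F(y),y-x\rangle$ is $C$-convex on $D$. Then there exists $x_0\in K$ such that $\langle F(y),y-x_0\rangle\notin -C\setminus\{0\}$ for all $y\in K$.
   Context: All vector spaces are real. $\operatorname{cl}$ denotes closure. $-C\setminus\{0\}$ denotes $(-C)\setminus\{0\}=-(C\setminus\{0\})$. The interior of $C$ is allowed to be empty. $L(X,Z)$ is the set of all linear and continuous operators from $X$ to $Z$; for $x^*\in L(X,Z)$ and $x\in X$, $\langle x^*,x\rangle$ denotes the vector $x^*(x)\in Z$. A set $C\subseteq Z$ is a cone if $tc\in C$ for all $c\in C$ and $t\ge 0$; it is convex if $C+C=C$, and pointed if $C\cap(-C)=\{0\}$. Write $z_1\le z_2$ iff $z_2-z_1\in C$. Strong $C$-upper semicontinuity: a map $g:K\to Z$ is strongly $C$-upper semicontinuous at $x\in K$ if for any $k\in C\setminus\{0\}$ there exists a neighborhood $U$ of $x$ such that $g(u)\in g(x)+k-(C\setminus\{0\})$ for all $u\in U\cap K$. It is strongly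 $C$-upper semicontinuous on a subset $S\subseteq K$ if it is so, as a map on $K$, at every point of $S$. $C$-convexity: for a (not necessarily convex) set $D$, $g$ is $C$-convex on $D$ if for all $n\in\mathbb N$, $x_1,\dots,x_n\in D$ and $\lambda_1,\dots,\lambda_n\ge 0$ with $\sum_{i=1}^n\lambda_i=1$ such that $\sum_{i=1}^n\lambda_i x_i\in D$, one has $g\left(\sum_{i=1}^n\lambda_i x_i\right)\le\sum_{i=1}^n\lambda_i g(x_i)$. Self segment-dense set: let $U\subseteq V\subseteq X$ with $V$ convex. $U$ is self segment-dense in $V$ if $U$ is dense in $V$ (i.e. $V\subseteq\operatorname{cl}U$) and for all $x,y\in U$ the set $[x,y]\cap U$ is dense in $[x,y]$, where $[x,y]=\{x+t(y-x):t\in[0,1]\}$. *)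

(* Defs.v *)
From HB Require Import structures.
From mathcomp Require Import all_boot all_order all_algebra.
From mathcomp Require Import all_classical all_reals all_analysis.

Set Implicit Arguments.
Unset Strict Implicit.
Unset Printing Implicit Defensive.

Import Order.TTheory GRing.Theory Num.Theory.
Import numFieldTopology.Exports.

Local Open Scope classical_set_scope.
Local Open Scope ring_scope.

HB.structure Definition LinearContinuous (R : numDomainType)
    (X Z : NbhsLmodule.type R) :=
  {f of @GRing.Linear R X Z *:%R f & @Continuous X Z f}.

Notation "{ 'linear_continuous' X -> Z }" := (@LinearContinuous.type _ X Z)
  (at level 0, X at level 98, Z at level 99,
   format "{ 'linear_continuous'  X  ->  Z }") : type_scope.

Section cones.
Context {R : realType} {Z : tvsType R}.
Implicit Types C : set Z.

Definition cone C := forall (t : R) (c : Z), 0 <= t -> C c -> C (t *: c).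

Definition convex_cone C := cone C /\ [set a + b | a in C & b in C] = C.

Definition pointed_cone C := cone C /\ C `&` (-%R @` C) = [set 0].

Definition cone_le C (z1 z2 : Z) := C (z2 - z1).

End cones.

Section maps.
Context {R : realType} {X Z : tvsType R}.
Implicit Types (C : set Z) (K D S : set X) (g : X -> Z).

(* A map on K is given by a total function on X whose values outside K are
   never used. *)
Definition strongly_usc_at C K g (x : X) :=
  forall k, (C `\ 0) k ->
    exists2 U, nbhs x U &
      forall u, (U `&` K) u -> [set g x + k - c | c in C `\ 0] (g u).

Definition strongly_usc_on C K g S := forall x, S x -> strongly_usc_at C K g x.

Definition C_convex_on C D g :=
  forall (n : nat) (x : 'I_n -> X) (lambda : 'I_n -> R),
    (forall i, D (x i)) -> (forall i, 0 <= lambda i) ->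
    \sum_(i < n) lambda i = 1 ->
    D (\sum_(i < n) lambda i *: x i) ->
    cone_le C (g (\sum_(i < n) lambda i *: x i))
              (\sum_(i < n) lambda i *: g (x i)).

End maps.

Section self_segment_dense.
Context {R : realType} {X : tvsType R}.
Implicit Types U V : set X.

(* Density relative to V; the library's [dense] is density in the whole space. *)
Definition dense_in U V := V `<=` closure U.

Definition segment (x y : X) : set X := [set x + t *: (y - x) | t in `[0, 1]].

Definition self_segment_dense U V :=
  [/\ U `<=` V, convex_set V, dense_in U V &
      forall x y, U x -> U y -> dense_in (segment x y `&` U) (segment x y)].

End self_segment_dense.

(* Main.v *)
(** It suffices to find [x] with [F y (y - x)] outside [- (C \ 0)] for all [y]
    in [D]: by (ii) the bad [y] outside [D] form a relatively open set, which
    would meet the dense set [D].  If there is no such [x], then by (i) and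
    compactness finitely many relatively open sets
    [A i = {x in K | F (y i) (y i - x) in - (C \ 0)}], with [y i] in [D], cover
    [K].  A KKM-type matching theorem yields a convex combination
    [x = \sum_i w i *: y i] lying in [D] and in every [A i] with [w i != 0].
    There (iii) gives [\sum_i w i *: F (y i) (y i - x)] in [C], although this
    sum is minus a nontrivial convex combination of elements of [C \ 0],
    against pointedness.

    The matching theorem comes from Scarf's lemma on finite sets carrying a
    family of linear orders, applied to the points of a fine grid in the
    simplex, ordered by each of their coordinates and coloured by an [i] such
    that [A i] contains a uniform neighbourhood of the point.  Self
    segment-density is what allows moving the resulting point into [D] without
    leaving the face of the simplex. *)

Require Import Defs.
From HB Require Import structures.
From mathcomp Require Import all_boot all_order all_algebra zify lra.

Set Implicit Arguments.
Unset Strict Implicit.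
Unset Printing Implicit Defensive.

(** * Scarf's lemma *)

Section DominantSets.
Variables (T I : finType) (r : I -> T -> nat).
Hypothesis r_inj : forall i, injective (r i).

(** Scarf's dominance: no point lies, for every [i] in [C], strictly above the [r i]-least point of
    [s]. For empty [s] and inhabited [T] it only says that [C] is nonempty. *)
Definition dominant (s : {set T}) (C : {set I}) :=
  [forall y, exists i in C, forall x in s, r i y <= r i x].

Lemma dominantP (s : {set T}) (C : {set I}) :
  reflect (forall y, exists2 i, i \in C & forall x, x \in s -> r i y <= r i x)
          (dominant s C).
Proof.
apply: (iffP forallP) => [h y|h y].
  by have /exists_inP [i iC /forall_inP hi] := h y; exists i.
by have [i iC hi] := h y; apply/exists_inP; exists i => //; apply/forall_inP.
Qed.

Lemma dominantS (s s' : {set T}) (C C' : {set I}) :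
  s' \subset s -> C \subset C' -> dominant s C -> dominant s' C'.
Proof.
move=> /subsetP ss /subsetP CC /dominantP h; apply/dominantP => y.
by have [i iC hi] := h y; exists i; [exact: CC | move=> x /ss /hi].
Qed.

(** Rooms and doors play the roles of simplices and facets in Sperner's lemma. A door leads to a
    room by adding a point or by discarding an index. *)
Definition room (p : {set T} * {set I}) :=
  (#|p.1| == #|p.2|) && dominant p.1 p.2.

Definition door (p : {set T} * {set I}) :=
  (#|p.2| == #|p.1|.+1) && dominant p.1 p.2.

Definition incident (d p : {set T} * {set I}) :=
  [exists (x | x \notin d.1), p == (x |: d.1, d.2)] ||
  [exists i in d.2, p == (d.1, d.2 :\ i)].

Lemma incidentP (d p : {set T} * {set I}) :
  reflect ((exists2 x, x \notin d.1 & p = (x |: d.1, d.2)) \/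
           (exists2 i, i \in d.2 & p = (d.1, d.2 :\ i)))
          (incident d p).
Proof.
apply: (iffP orP) => -[].
- by move=> /exists_inP [x xd /eqP ->]; left; exists x.
- by move=> /exists_inP [i id /eqP ->]; right; exists i.
- by move=> [x xd ->]; left; apply/exists_inP; exists x.
- by move=> [i id ->]; right; apply/exists_inP; exists i.
Qed.

(** Discarding [i] leaves no index to witness dominance, and an added point must be the
    [r i]-greatest one. *)
Lemma outer_door_rooms (x0 : T) (i : I) :
  #|[set p | room p & incident (set0, [set i]) p]| = 1.
Proof.
have [y _ hy'] := @arg_maxnP T x0 predT (r i) isT.
have {hy'} hy z : r i z <= r i y by exact: hy'.
apply/eqP/cards1P; exists ([set y], [set i]); apply/setP => p.
rewrite !inE; apply/andP/eqP => [[/andP [_ dom] /incidentP /= []]|->].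
- move=> [x _ e]; move: dom; rewrite e setU0 /= => /dominantP /(_ y) [j].
  rewrite inE => /eqP -> /(_ x (set11 x)) h.
  suff -> : y = x by [].
  by apply: (@r_inj i); apply/eqP; rewrite eqn_leq h hy.
- move=> [j]; rewrite inE => /eqP -> e; move: dom.
  by rewrite e /= => /dominantP /(_ x0) [k]; rewrite setDv inE.
- split.
    rewrite /room /= !cards1 eqxx; apply/dominantP => z; exists i.
      by rewrite set11.
    by move=> x /set1P ->; apply: hy.
  by apply/incidentP; left; exists y; rewrite /= ?inE ?setU0.
Qed.

(* [m i] is the [r i]-least point of [t].  Dominance makes [m] map [D] onto
   [t], so exactly one pair [i != j] in [D] has [m i = m j]; the two rooms [R i]
   and [R j] are obtained by trying to drop [i] or [j] from [D]. *)
Lemma inner_door_rooms (t : {set T}) (D : {set I}) :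
  t != set0 -> door (t, D) -> #|[set p | room p & incident (t, D) p]| = 2.
Proof.
case/set0Pn => x0 x0t /andP [/= /eqP cD dom]; have /dominantP domP := dom.
pose m i := [arg min_(x < x0 in t) r i x].
have mt i : m i \in t by rewrite /m; case: arg_minnP.
have mmin i x : x \in t -> r i (m i) <= r i x.
  by rewrite /m; case: arg_minnP => // y _ h /h.
have mE i x : x \in t -> (forall z, z \in t -> r i x <= r i z) -> x = m i.
  move=> xt h; apply: (@r_inj i); apply/eqP.
  by rewrite eqn_leq (h _ (mt i)) mmin.
have mD : m @: D = t.
  apply/eqP; rewrite eqEsubset; apply/andP; split; apply/subsetP => x.
    by case/imsetP => i _ ->.
  move=> xt; have [i iD hi] := domP x; apply/imsetP; exists i => //.
  exact: mE.
have [i iD [j jD [ij mij]]] :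
    exists2 i, i \in D & exists2 j, j \in D & i != j /\ m i = m j.
  have : ~~ [forall i in D, forall j in D, (m i == m j) ==> (i == j)].
    apply/negP => /forall_inP h.
    have : #|m @: D| = #|D|.
      apply: card_in_imset => i j iD jD e.
      by have /forall_inP /(_ j jD) := h i iD; rewrite e eqxx => /eqP.
    by rewrite mD cD => /n_Sn.
  rewrite negb_forall_in => /exists_inP [i iD].
  rewrite negb_forall_in => /exists_inP [j jD].
  rewrite negb_imply => /andP [/eqP e ne]; exists i => //; exists j => //.
have surj k : k \in [set i; j] -> m @: (D :\ k) = t.
  rewrite !inE => hk; apply/eqP; rewrite eqEsubset; apply/andP; split.
    by apply/subsetP => x /imsetP [l _ ->].
  apply/subsetP => x; rewrite -{1}mD => /imsetP [l lD ->]; apply/imsetP.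
  have [elk|nlk] := eqVneq l k; last by exists l => //; rewrite !inE nlk.
  subst l; case/orP: hk => /eqP ->.
    by exists j; rewrite ?inE ?jD ?andbT 1?eq_sym.
  by exists i; rewrite ?inE ?iD ?andbT.
have cDk k : k \in D -> #|D :\ k| = #|t|.
  by move=> kD; move: cD; rewrite (cardsD1 k D) kD => -[].
have inj k : k \in D -> t \subset m @: (D :\ k) -> {in D :\ k &, injective m}.
  move=> kD tk; apply/imset_injP; rewrite eqn_leq leq_imset_card /=.
  by rewrite cDk //; apply: subset_leq_card.
have ijP k : k \in D -> t \subset m @: (D :\ k) -> k \in [set i; j].
  move=> kD tk; rewrite !inE; apply: contraT; rewrite negb_or => /andP [ki kj].
  case/eqP: ij; apply: (inj k kD tk) => //.
    by rewrite !inE iD eq_sym ki.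
  by rewrite !inE jD eq_sym kj.
have ijD k : k \in [set i; j] -> k \in D.
  by rewrite !inE => /orP [] /eqP ->.
(* [M k] consists of the points that prevent [(t, D :\ k)] from being dominant. If there are any,
   [k] is kept and the [r k]-greatest of them is added to [t]. *)
pose M k := [set y | [forall l in D :\ k, r l (m l) < r l y]].
have MP k y : reflect (forall l, l \in D -> l != k -> r l (m l) < r l y)
                      (y \in M k).
  rewrite inE; apply: (iffP forall_inP) => h l.
    by move=> lD lk; apply: h; rewrite !inE lk.
  by rewrite !inE => /andP [lk lD]; apply: h.
pose R k := if [pick y in M k] is Some y
  then ([arg max_(z > y in M k) r k z] |: t, D) else (t, D :\ k).
have RP k p : p = R k <-> (p = (t, D :\ k) /\ M k = set0) \/
    exists y, [/\ p = (y |: t, D), y \in M k &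
                forall z, z \in M k -> r k z <= r k y].
  rewrite /R; case: pickP => [y yM|M0].
    case: arg_maxnP => // w wM wmax; split => [->|[[_ e]|[z [-> zM zmax]]]].
    - by right; exists w; split.
    - by rewrite e inE in yM.
    - suff -> : w = z by [].
      by apply: (@r_inj k); apply/eqP; rewrite eqn_leq zmax //; exact: wmax.
  have e : M k = set0 by apply/setP => y; rewrite M0 inE.
  split => [->|[[-> _]//|[y [_]]]]; first by left.
  by rewrite M0.
have Mt k y : k \in [set i; j] -> y \in M k -> y \notin t.
  move=> hk /MP yM; apply/negP; rewrite -{1}(surj k hk) => /imsetP [l].
  rewrite !inE => /andP [lk lD] e; have := yM l lD lk; rewrite e.
  by rewrite ltnNge mmin.
have Rin k : k \in [set i; j] -> room (R k) && incident (t, D) (R k).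
  move=> hk; have kD := ijD k hk.
  have [[-> e]|[y [-> yM ymax]]] := (RP k (R k)).1 erefl.
    apply/andP; split; last by apply/incidentP; right; exists k.
    apply/andP; split.
      by rewrite /= cDk.
    apply/dominantP => /= y.
    have /forall_inPn [l lD] : ~~ [forall l in D :\ k, r l (m l) < r l y].
      by have := in_set0 y; rewrite -e inE => ->.
    rewrite -leqNgt => h; exists l => // x xt.
    exact: leq_trans h (mmin l x xt).
  have yt := Mt k y hk yM.
  apply/andP; split; last by apply/incidentP; left; exists y.
  apply/andP; split; first by rewrite /= cardsU1 yt cD.
  apply/forallP => /= z; apply: contraT => /exists_inPn hz.
  have {}hz l : l \in D -> exists2 x, x \in y |: t & r l x < r l z.
    by move=> /hz /forall_inPn [x xt]; rewrite -ltnNge; exists x.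
  have zM : z \in M k.
    apply/MP => l lD lk; have [x] := hz l lD.
    case/setU1P => [->|xt h]; last exact: leq_ltn_trans (mmin l x xt) h.
    by apply: ltn_trans; move/MP : yM; apply.
  have [l lD hl] := domP z; have [elk|nlk] := eqVneq l k; last first.
    by move/MP : zM => /(_ l lD nlk); rewrite ltnNge hl.
  subst l; have [x] := hz k kD; case/setU1P => [->|xt].
    by rewrite ltnNge ymax.
  by rewrite ltnNge hl.
have only p : room p -> incident (t, D) p ->
    exists2 k, k \in [set i; j] & p = R k.
  case/andP => _ /[swap] /incidentP /= [[y yt ->]|[k kD ->]] /= /dominantP pdom.
  (* [y] is the [r k]-least point of [y |: t], and each point of [t] is least for some other index.
     So [m] maps [D :\ k] onto [t], which forces [k] to be [i] or [j]. *)
  - have [k kD hk] := pdom y.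
    have tk x : x \in t ->
        exists l, [/\ l \in D :\ k, x = m l & r l x <= r l y].
      move=> xt; have [l lD hl] := pdom x; exists l; split.
      + rewrite !inE lD andbT; apply: contraNneq yt => elk; subst l.
        suff -> : y = x by [].
        apply: (@r_inj k); apply/eqP.
        by rewrite eqn_leq hk ?hl ?inE ?xt ?eqxx ?orbT.
      + by apply: mE => // z zt; apply: hl; rewrite inE zt orbT.
      + by apply: hl; rewrite !inE eqxx.
    have sk : t \subset m @: (D :\ k).
      apply/subsetP => x /tk [l [lD -> _]]; exact: imset_f.
    exists k; first exact: ijP.
    apply/RP; right; exists y; split=> //.
      apply/MP => l lD lk; have [l' [l'D e h]] := tk (m l) (mt l).
      have ell : l = l' by apply: (inj k kD sk) => //; rewrite !inE lk.
      rewrite -ell in h; rewrite ltn_neqAle h andbT.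
      by apply: contraNneq yt => /r_inj <-.
    move=> z /MP zM; have [l lD hl] := pdom z.
    have [elk|nlk] := eqVneq l k; last first.
      by have := zM l lD nlk; rewrite ltnNge hl // inE mt orbT.
    by subst l; apply: hl; rewrite !inE eqxx.
  - have sk : t \subset m @: (D :\ k).
      apply/subsetP => x xt; have [l lD hl] := pdom x.
      by apply/imsetP; exists l => //; apply: mE.
    exists k; first exact: ijP.
    apply/RP; left; split=> //; apply/setP => y; rewrite in_set0.
    apply/negP => /MP yM; have [l] := pdom y.
    by rewrite !inE => /andP [lk lD] /(_ (m l) (mt l)); rewrite leqNgt yM.
have Rij : R i <> R j.
  move=> e; have [[e1 M0]|[y [e1 yM ymax]]] := (RP i (R i)).1 erefl.
    have [[e2 _]|[y [e2 _ _]]] := (RP j (R j)).1 erefl.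
      move: e; rewrite e1 e2 => -[] /setP /(_ i).
      by rewrite !inE iD eqxx ij.
    move: e; rewrite e1 e2 => -[] _ /setP /(_ i).
    by rewrite !inE iD eqxx.
  have [[e2 _]|[z [e2 zM _]]] := (RP j (R j)).1 erefl.
    move: e; rewrite e1 e2 => -[] _ /setP /(_ j).
    by rewrite !inE jD eqxx.
  have hi : i \in [set i; j] by rewrite !inE eqxx.
  have hj : j \in [set i; j] by rewrite !inE eqxx orbT.
  (* If both rooms add the same point, it lies strictly above [m l] for every [l] in [D], against
     the dominance of [(t, D)]. *)
  have eyz : y = z.
    move: e; rewrite e1 e2 => -[] /setP /(_ y).
    by rewrite !inE eqxx (negPf (Mt _ _ hi yM)) !orbF => /esym /eqP.
  rewrite -eyz in zM; have [l lD hl] := domP y.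
  have := hl _ (mt l); have [eli|nli] := eqVneq l i.
    by move/MP : zM => /(_ i iD ij); rewrite eli ltnNge => /negPf ->.
  by move/MP : yM => /(_ l lD nli); rewrite ltnNge => /negPf ->.
apply/eqP/cards2P; exists (R i), (R j); split; first exact/eqP.
apply/setP => p; rewrite !inE; apply/andP/orP.
  case=> /only h /h [k]; rewrite !inE => /orP [] /eqP -> ->; first by left.
  by right.
by case=> /eqP ->; apply/andP; apply: Rin; rewrite !inE eqxx ?orbT.
Qed.

(** * Colourings and the parity of almost colourful doors *)

Section Colouring.
Variables (c : T -> I) (i0 : I).

(** The points of such a door carry exactly the colours of its index set other than [i0], by
    cardinality each of them once. *)
Definition almost_colourful (d : {set T} * {set I}) :=
  [&& door d, i0 \in d.2 & c @: d.1 == d.2 :\ i0].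

(** There are 0 or 2 such doors. If there is one, some [s :\ x] carries each colour of [C :\ i0]
    once, and [c x != i0] since the room is not colourful. One door removes [x]; the other removes
    the second point of colour [c x] if [c x] is in [C], and adds the index [c x] otherwise. *)
Lemma almost_colourful_doors_even p : room p -> c @: p.1 != p.2 ->
  ~~ odd #|[set d | almost_colourful d & incident d p]|.
Proof.
move: p => [s C] /andP [/= /eqP sC dom] nc.
set E := [set d | _].
have doorl x : x \in s -> door (s :\ x, C).
  move=> xs; apply/andP; split; first by rewrite /= -sC (cardsD1 x) xs.
  by apply: dominantS dom => //=; rewrite subD1set.
have doorr j : j \notin C -> door (s, j |: C).
  move=> jC; apply/andP; split; first by rewrite /= cardsU1 jC sC.
  by apply: dominantS dom => //=; rewrite subsetUr.
have incE d : incident d (s, C) <-> (exists2 x, x \in s & d = (s :\ x, C)) \/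
    (exists2 j, j \notin C & d = (s, j |: C)).
  split=> [/incidentP [[x xd [-> ->]]|[j jd [-> ->]]]|[[x xs ->]|[j jC ->]]].
  - left; exists x; first by rewrite !inE eqxx.
    by rewrite setU1K //; case: d {xd} => [].
  - right; exists j; first by rewrite !inE eqxx.
    by rewrite setD1K //; case: d {jd} => [].
  - apply/incidentP; left; exists x; rewrite /= ?inE ?eqxx //.
    by rewrite setD1K.
  - apply/incidentP; right; exists j; rewrite /= ?inE ?eqxx //.
    by rewrite setU1K.
have inE1 x : x \in s ->
    ((s :\ x, C) \in E) = (i0 \in C) && (c @: (s :\ x) == C :\ i0).
  move=> xs; rewrite inE /almost_colourful doorl //=.
  suff -> : incident (s :\ x, C) (s, C) by rewrite andbT.
  by apply/incE; left; exists x.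
have inE2 j : j \notin C -> ((s, j |: C) \in E) =
    (i0 \in j |: C) && (c @: s == (j |: C) :\ i0).
  move=> jC; rewrite inE /almost_colourful doorr //=.
  suff -> : incident (s, j |: C) (s, C) by rewrite andbT.
  by apply/incE; right; exists j.
have injE x : x \in s -> i0 \in C -> C :\ i0 \subset c @: (s :\ x) ->
    {in s :\ x &, injective c} /\ c @: (s :\ x) = C :\ i0.
  move=> xs i0C sub.
  have e : #|s :\ x| = #|C :\ i0|.
    by move: sC; rewrite (cardsD1 x s) xs (cardsD1 i0 C) i0C => -[].
  have le := subset_leq_card sub; have le' := leq_imset_card c (s :\ x).
  split; first by apply/imset_injP; rewrite eqn_leq le' e.
  by apply/esym/eqP; rewrite eqEcard sub -e.
have [->|[d dE]] := set_0Vmem E; first by rewrite cards0.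
have [x [xs i0C cx]] :
    exists x, [/\ x \in s, i0 \in C & c @: (s :\ x) = C :\ i0].
  move: (dE); rewrite inE => /andP [_ /incE [[x xs ed]|[j jC ed]]].
    by exists x; move: dE; rewrite ed inE1 // => /andP [-> /eqP].
  move: dE; rewrite ed inE2 // => /andP [i0j /eqP cs].
  have ji : j != i0.
    by apply: contraNneq nc => e; rewrite cs -e setU1K.
  have i0C : i0 \in C by move: i0j; rewrite !inE eq_sym (negPf ji).
  have : j \in c @: s by rewrite cs !inE ji eqxx.
  case/imsetP => x xs ejx; exists x; split=> //; apply: (injE x xs i0C _).2.
  apply/subsetP => k; rewrite !inE => /andP [ki kC].
  have : k \in c @: s by rewrite cs !inE ki kC orbT.
  case/imsetP => z zs ekz; apply/imsetP; exists z => //.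
  rewrite !inE zs andbT; apply: contraNneq jC => ezx.
  by rewrite ejx -ezx -ekz.
have cinj : {in s :\ x &, injective c}.
  by apply: (injE x xs i0C _).1; rewrite cx.
have cs : c @: s = c x |: (C :\ i0) by rewrite -cx -imsetU1 setD1K.
have ui0 : c x != i0.
  by apply: contraNneq nc => e; rewrite cs e setD1K.
have [uC|uC] := boolP (c x \in C).
- have : c x \in c @: (s :\ x) by rewrite cx !inE ui0.
  case/imsetP => x'; rewrite !inE => /andP [x'x x's] cxx'.
  have e : c @: (s :\ x') = C :\ i0.
    apply: (injE x' x's i0C _).2; rewrite -cx; apply/subsetP => k.
    case/imsetP => z; rewrite !inE => /andP [zx zs] ->.
    have [->|zx'] := eqVneq z x'.
      by rewrite -cxx'; apply: imset_f; rewrite !inE eq_sym x'x.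
    by apply: imset_f; rewrite !inE zx'.
  suff -> : E = [set (s :\ x, C); (s :\ x', C)].
    rewrite cards2; suff -> : (s :\ x, C) != (s :\ x', C) by [].
    apply/eqP => -[] /setP /(_ x); rewrite !inE eqxx xs eq_sym.
    by rewrite (negPf x'x).
  apply/setP => d'; rewrite [RHS]inE !in_set1; apply/idP/orP; last first.
    by case=> /eqP ->; rewrite inE1 // i0C ?cx ?e eqxx.
  move=> d'E; move: (d'E); rewrite inE => /andP [_ /incE [[z zs ed]|[j jC ed]]].
    move: d'E; rewrite ed inE1 // i0C /= => /eqP cz.
    have [->|zx] := eqVneq z x; first by left.
    have [->|zx'] := eqVneq z x'; first by right.
    have [zinj _] : {in s :\ z &, injective c} /\ c @: (s :\ z) = C :\ i0.
      by apply: injE; rewrite ?cz.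
    case/eqP: x'x; apply: zinj; rewrite ?inE //.
      by rewrite x's eq_sym zx'.
    by rewrite xs eq_sym zx.
  move: d'E; rewrite ed inE2 // cs => /andP [_ /eqP /setP /(_ j)].
  rewrite !inE (negPf jC) andbF orbF eqxx andbT.
  have -> : j != i0 by apply: contraNneq jC => ->.
  by move=> /eqP ejx; rewrite ejx uC in jC.
- suff -> : E = [set (s :\ x, C); (s, c x |: C)].
    rewrite cards2; suff -> : (s :\ x, C) != (s, c x |: C) by [].
    by apply/eqP => -[] /setP /(_ x); rewrite !inE eqxx xs.
  apply/setP => d'; rewrite [RHS]inE !in_set1; apply/idP/orP; last first.
    case=> /eqP ->; first by rewrite inE1 // i0C cx eqxx.
    rewrite inE2 // !inE i0C orbT /= cs; apply/eqP/setP => k; rewrite !inE.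
    by have [->|] := eqVneq k (c x); rewrite ?ui0.
  move=> d'E; move: (d'E); rewrite inE => /andP [_ /incE [[z zs ed]|[j jC ed]]].
    move: d'E; rewrite ed inE1 // i0C /= => /eqP cz.
    have [->|zx] := eqVneq z x; first by left.
    have : c x \in c @: (s :\ z) by apply: imset_f; rewrite !inE eq_sym zx.
    by rewrite cz !inE (negPf uC) andbF.
  move: d'E; rewrite ed inE2 // cs => /andP [_ /eqP /setP /(_ (c x))].
  rewrite !inE eqxx ui0 (negPf uC) orbF /= => /esym /eqP <-.
  by right.
Qed.

(* If no room were colourful, counting the incidences between rooms and almost
   colourful doors would give an even number by rooms, and an odd one by doors,
   since only [(set0, [set i0])] lies in a single room. *)
Lemma scarf (x0 : T) :
  exists s : {set T}, exists2 C : {set I}, dominant s C & c @: s = C.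
Proof.
have [|none] := boolP [exists p, room p && (c @: p.1 == p.2)].
  case/existsP => -[s C] /andP [/andP [_ dom] /eqP e].
  by exists s; exists C.
pose N := \sum_(d | almost_colourful d) \sum_(p | room p) incident d p.
have card1 (A B : pred ({set T} * {set I})) :
    \sum_(p | A p) B p = #|[set p | A p & B p]|.
  rewrite -sum1dep_card big_mkcondr /=.
  by apply: eq_bigr => p _; case: (B p).
have outer : almost_colourful (set0, [set i0]).
  apply/and3P; split=> /=; rewrite ?inE ?imset0 ?setDv //.
  rewrite /door /= cards1 cards0 eqxx; apply/dominantP => y.
  by exists i0; rewrite ?inE // => x; rewrite inE.
have : odd N.
  rewrite /N (bigD1 _ outer) /= card1 outer_door_rooms // oddD /=.
  elim/big_rec: _ => [//|d a /andP [/and3P [dd i0d cd] nd]].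
  rewrite oddD negb_add => /negPf ->; rewrite eqbF_neg card1.
  case: d dd i0d cd nd => t D dd i0d cd nd.
  (* An almost colourful door without points has the single index [i0], so it is the outer door. *)
  rewrite inner_door_rooms //; apply: contraNneq nd => /= t0.
  move: cd dd => /=; rewrite t0 imset0 /door /= cards0 => /eqP e /andP [cD _].
  have := setD1K i0d; rewrite /= -e => <-.
  by apply/eqP; congr pair; rewrite setU0.
suff : ~~ odd N by move/negPf ->.
rewrite /N exchange_big /=; elim/big_ind: _ => // [a b|p rp].
  by rewrite oddD => /negPf -> /negPf ->.
rewrite card1; apply: almost_colourful_doors_even => //.
by move: none => /existsPn /(_ p); rewrite rp.
Qed.

End Colouring.
End DominantSets.

(** * Grids in the simplex *)

(** [a] stands for the point of the simplex with barycentric coordinates [a i / N]; the bound on the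
    values makes the type finite. *)
Definition grid n N := {a : {ffun 'I_n -> 'I_N.+1} | \sum_i a i == N}.

Lemma grid_of n N (f : 'I_n -> nat) : \sum_i f i = N ->
  exists a : grid n N, forall i, val a i = f i :> nat.
Proof.
move=> fN; have fle i : f i < N.+1.
  by rewrite ltnS -fN (bigD1 i) //= leq_addr.
pose a := [ffun i => Ordinal (fle i)].
have aN : \sum_i a i == N.
  by apply/eqP; rewrite -[RHS]fN; apply: eq_bigr => i _; rewrite ffunE.
by exists (exist _ a aN) => i; rewrite /= ffunE.
Qed.

(** Scarf's lemma gives a dominant [s] whose set of colours is [C]. The coordinate minima of [s]
    over [C] have a sum in [(N - n, N]], so every point of [s] is close to these minima on [C] and
    close to 0 off [C]. *)
Lemma grid_matching n N (c : grid n N -> 'I_n) : 0 < n ->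
  exists (C : {set 'I_n}) (b : 'I_n -> nat),
    [/\ \sum_i b i = N, forall i, i \notin C -> b i = 0 &
        forall i, i \in C -> exists2 a : grid n N, c a = i &
          forall j, (val a j <= b j + n) && (b j <= val a j + n)].
Proof.
move=> n0; pose i0 := Ordinal n0.
have sum1 (k : 'I_n) v : \sum_i (i == k) * v = v.
  by rewrite (bigD1 k) //= eqxx mul1n big1 ?addn0 // => i /negPf ->.
have sumC (C : {set 'I_n}) (g : 'I_n -> nat) :
    \sum_i (i \in C) * g i = \sum_(i in C) g i.
  by rewrite [RHS]big_mkcond; apply: eq_bigr => i _; case: (i \in C);
    rewrite ?mul1n.
have [x0 _] := grid_of (sum1 i0 N).
(* Coordinate [i], ties being broken by the enumeration of the grid. *)
pose r (i : 'I_n) (a : grid n N) := val a i * #|{: grid n N}| + enum_rank a.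
have r_inj i : injective (r i).
  move=> a b /(congr1 (modn^~ #|{: grid n N}|)).
  by rewrite !modnMDl !modn_small // => /val_inj /enum_rank_inj.
have r_lt i (a b : grid n N) : val a i < val b i -> r i a < r i b.
  move=> h; rewrite /r.
  apply: (@leq_trans (val a i * #|{: grid n N}| + #|{: grid n N}|)).
    by rewrite ltn_add2l.
  by rewrite -mulSnr (leq_trans _ (leq_addr _ _)) // leq_mul2r h orbT.
have [s [C /dominantP dom cs]] := scarf r_inj c i0 x0.
have [k kC _] := dom x0.
have [x1 x1s _] : exists2 x, x \in s & k = c x by apply/imsetP; rewrite cs.
pose m (i : 'I_n) : nat := val [arg min_(x < x1 in s) val x i] i.
have mle i (x : grid n N) : x \in s -> m i <= val x i.
  by rewrite /m; case: arg_minnP => // y _ h /h.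
have mex i : exists2 x, x \in s & m i = val x i.
  by rewrite /m; case: arg_minnP => // y ys _; exists y.
pose S := \sum_(i in C) m i.
have xN (x : grid n N) : \sum_i val x i = N by apply/eqP; case: x.
have SxN j (x : grid n N) : x \in s -> val x j + S <= N + (j \in C) * m j.
  move=> xs; rewrite -[X in _ <= X + _](xN x) (bigD1 j) //= -addnA leq_add2l.
  rewrite addnC /S -sumC (bigD1 j) //= leq_add2l; apply: leq_sum => i _.
  by case: (i \in C); rewrite ?mul1n ?mle.
(* Otherwise some grid point exceeds all the minima [m i], [i \in C]. *)
have NS : N < S + #|C|.
  rewrite ltnNge; apply/negP => h.
  pose y i := (i \in C) * (m i).+1 + (i == i0) * (N - (S + #|C|)).
  have yN : \sum_i y i = N.
    rewrite big_split /= sum1 sumC.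
    have -> : \sum_(i in C) (m i).+1 = S + #|C|.
      by rewrite -sum1_card -big_split; apply: eq_bigr => i _; rewrite /= addn1.
    exact: subnKC.
  have [a ha] := grid_of yN; have [i iC hi] := dom a.
  have [x xs mx] := mex i; have := hi x xs; apply/negP; rewrite -ltnNge.
  by apply: r_lt; rewrite ha -mx /y iC mul1n leq_addr.
have Cn : #|C| <= n by rewrite -[n in _ <= n]card_ord max_card.
have SN : S <= N.
  by have := SxN k x1 x1s; have := mle k x1 x1s; rewrite kC mul1n; lia.
(* The missing mass [N - S], less than [n], is put on one index [k] of [C], which makes the sum
   exactly [N]. *)
exists C, (fun j => (j \in C) * m j + (j == k) * (N - S)); split.
- by rewrite big_split /= sum1 sumC subnKC.
- move=> i iC; rewrite (negPf iC); have -> // : (i == k) = false.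
  by apply: contraNF iC => /eqP ->.
- move=> i; rewrite -{1}cs => /imsetP [a as_ ->]; exists a => // j.
  have := SxN j a as_; have := mle j a as_.
  by case: (j \in C); case: (j == k); lia.
Qed.

(* Imported only here: the classical set notations and lemma names shadow those
   of [finset] used above. *)
From mathcomp Require Import all_classical all_reals all_analysis.

Import Order.TTheory GRing.Theory Num.Theory.
Import numFieldTopology.Exports.

Local Open Scope classical_set_scope.
Local Open Scope ring_scope.

(** * Convex combinations and covers of compact convex sets *)

Section ConvexCombinations.
Context {R : realType}.

Lemma convex_set_segment (X : lmodType R) (E : set X) (x y : X) (t : R) :
  convex_set E -> E x -> E y -> 0 <= t <= 1 -> E (x + t *: (y - x)).
Proof.
move=> cE Ex Ey /andP [t0]; rewrite le_eqVlt => /orP [/eqP ->|t1].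
  by rewrite scale1r addrC subrK.
move: t0; rewrite le_eqVlt => /orP [/eqP <-|t0].
  by rewrite scale0r addr0.
have := (iffLR (convex_setW E) cE) y x (mem_set Ey) (mem_set Ex).
move=> /(_ (Itv01 (ltW t0) (ltW t1)) t0 t1).
rewrite inE; congr E.
rewrite /conv /= scalerBr /Itv01 /= scalerBl scale1r.
by rewrite addrC -addrA [- _ + _]addrC.
Qed.

(** The points are added one at a time, the earlier ones being renormalised. [S] only has to be
    stable under moving towards points of [Q], so that it may be the closure of a nonconvex set. *)
Lemma convex_comb_ind (X : lmodType R) (S Q : set X) :
  Q `<=` S ->
  (forall u y t, S u -> Q y -> 0 <= t <= 1 -> S (u + t *: (y - u))) ->
  forall n (w : 'I_n -> R) (y : 'I_n -> X), (forall i, 0 <= w i) ->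
  \sum_i w i = 1 -> (forall i, w i != 0 -> Q (y i)) ->
  S (\sum_i w i *: y i).
Proof.
move=> QS step; elim=> [|n IHn] w y w0.
  by rewrite big_ord0 => /esym/eqP; rewrite oner_eq0.
rewrite !big_ord_recl; set s := \sum_(i < n) _ => ws yQ.
have s0 : 0 <= s by apply: sumr_ge0 => i _.
have [es|ns] := eqVneq s 0.
  have wl i : w (lift ord0 i) = 0.
    apply/eqP; move/eqP : es; rewrite psumr_eq0 // => /allP/(_ i); apply.
    by rewrite mem_index_enum.
  rewrite big1 => [|i _]; last by rewrite wl scale0r.
  have w1 : w ord0 = 1 by rewrite -ws es addr0.
  by rewrite addr0 w1 scale1r; apply/QS/yQ; rewrite w1 oner_neq0.
have Su : S (\sum_i (s^-1 * w (lift ord0 i)) *: y (lift ord0 i)).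
  apply: IHn => [i||i].
  - by rewrite mulr_ge0 // invr_ge0.
  - by rewrite -mulr_sumr mulVf.
  - by rewrite mulf_eq0 negb_or => /andP [_ /yQ].
have -> : \sum_i w (lift ord0 i) *: y (lift ord0 i) =
    s *: \sum_i (s^-1 * w (lift ord0 i)) *: y (lift ord0 i).
  rewrite scaler_sumr; apply: eq_bigr => i _.
  by rewrite scalerA mulrA divff // mul1r.
have {ws} ws : s = 1 - w ord0 by rewrite -ws addrC addKr.
move: Su; set u := \sum_i _ => Su.
have -> : w ord0 *: y ord0 + s *: u = u + w ord0 *: (y ord0 - u).
  by rewrite ws scalerBl scale1r scalerBr addrCA.
have [ew|nw] := eqVneq (w ord0) 0; first by rewrite ew scale0r addr0.
apply: step => //; first exact: yQ.
by rewrite w0 /= -subr_ge0 -ws.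
Qed.

Lemma convex_set_comb (X : lmodType R) (E : set X) n (w : 'I_n -> R)
    (y : 'I_n -> X) : convex_set E -> (forall i, 0 <= w i) ->
  \sum_i w i = 1 -> (forall i, w i != 0 -> E (y i)) -> E (\sum_i w i *: y i).
Proof.
move=> cE; apply: convex_comb_ind => // u z t Eu Ez.
exact: convex_set_segment.
Qed.

Lemma convex_set_hull (X : lmodType R) n (y : 'I_n -> X) (C : {set 'I_n}) :
  convex_set [set x | exists w : 'I_n -> R, [/\ forall i, 0 <= w i,
    \sum_i w i = 1, forall i, i \notin C -> w i = 0 & x = \sum_i w i *: y i]].
Proof.
apply/convex_setW => a b /[!inE] -[v [v0 v1 vC ->]] [w [w0 w1 wC ->]] l _ _.
rewrite inE; exists (fun i => l%:num * v i + (1 - l%:num) * w i); split.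
- by move=> i; rewrite addr_ge0 // mulr_ge0 // subr_ge0.
- by rewrite big_split /= -!mulr_sumr v1 w1 !mulr1 addrC subrK.
- by move=> i iC; rewrite vC // wC // !mulr0 addr0.
- rewrite /conv /= !scaler_sumr -big_split; apply: eq_bigr => i _.
  by rewrite [RHS]scalerDl !scalerA.
Qed.

End ConvexCombinations.

(** * Uniform neighbourhoods and density in topological vector spaces *)

Section Topology.
Context {R : realType} {X : tvsType R}.

Lemma nbhs0_add (V : set X) : nbhs 0 V ->
  exists2 W, nbhs 0 W & forall a b, W a -> W b -> V (a + b).
Proof.
move=> V0; have := @add_continuous X (0, 0) V; rewrite /= addr0.
move=> /(_ V0) [[A B] /= [A0 B0] AB].
exists (A `&` B); first exact: filterI.
by move=> a b [Aa _] [_ Bb]; exact: (AB (a, b)).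
Qed.

(** Lebesgue's number lemma, with a neighbourhood of 0 as the radius. The required property passes
    to smaller [V], so compactness applies along the filter of small neighbourhoods of 0. The
    condition [K u] makes neighbourhoods relative to [K]. *)
Lemma lebesgue_cover (I : Type) (K : set X) (A : I -> set X) : compact K ->
  (forall x, K x -> exists i, nbhs x [set u | K u -> A i u]) ->
  exists2 V, nbhs 0 V &
    forall x, K x -> exists i, forall v, V v -> K (x + v) -> A i (x + v).
Proof.
move=> /compact_near_coveringP cK cover.
pose P (V : set X) x := exists i, forall v, V v -> K (x + v) -> A i (x + v).
have PS V W : V `<=` W -> P W `<=` P V.
  by move=> VW x [i hi]; exists i => v /VW; apply: hi.
suff : \forall V \near powerset_filter_from (nbhs (0 : X)), K `<=` P V.
  move/near_powerset_filter_fromP => [V W /PS h Kx|V V0 KV].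
    exact: subset_trans Kx h.
  by exists V.
apply: cK => x Kx; have [i iU] := cover x Kx.
have := @add_continuous X (x, 0) [set u | K u -> A i u]; rewrite /= addr0.
move=> /(_ iU) [[B W] /= [Bx W0] BW].
exists (B, [set V | V `<=` W]); last first.
  by move=> [x' V] /= [Bx' VW]; exists i => v /VW Wv; exact: (BW (x', v)).
split=> //=; apply/near_powerset_filter_fromP; last by exists W.
by move=> V V' h h'; exact: subset_trans h h'.
Qed.

(** Continuity at zero coefficients; it turns a bound on barycentric coordinates into closeness in
    [X]. *)
Lemma small_comb n (y : 'I_n -> X) (V : set X) : nbhs 0 V ->
  exists2 d : R, 0 < d & forall t : 'I_n -> R,
    (forall i, `|t i| <= d) -> V (\sum_i t i *: y i).
Proof.
elim: n y V => [|n IHn] y V V0.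
  exists 1 => // t _; rewrite big_ord0; exact: nbhs_singleton.
have [W W0 WV] := nbhs0_add V0.
have [d d0 hd] := IHn (fun i => y (lift ord0 i)) W W0.
have := @scale_continuous R X (0, y ord0) W; rewrite /= scale0r.
move=> /(_ W0) [[A B] /= [A0 B0] AB].
have [e /= e0 he] := (iffLR (@nbhs_ballP R R^o 0 A)) A0.
exists (Num.min d (e / 2)) => [|t ht].
  by rewrite lt_min d0 divr_gt0.
rewrite big_ord_recl; apply: WV; last first.
  by apply: hd => i; apply: le_trans (ht _) _; rewrite ge_min lexx.
apply: (AB (t ord0, y ord0)); split=> /=; last exact: nbhs_singleton.
apply: he; rewrite /ball /= sub0r normrN; apply: le_lt_trans (ht ord0) _.
rewrite gt_min; apply/orP; right; lra.
Qed.

(** The closure of [D] intersected with [E] is stable under moving towards a point [z] of that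
    intersection: a limit point [u] is replaced by a nearby [v] in the intersection, then a nearby
    point of [D] is taken on the segment from [v] to [z], which lies in [E]. *)
Lemma segment_dense_comb (D E : set X) n (w : 'I_n -> R) (y : 'I_n -> X) :
  (forall x z, D x -> D z -> dense_in (segment x z `&` D) (segment x z)) ->
  convex_set E -> (forall i, 0 <= w i) -> \sum_i w i = 1 ->
  (forall i, w i != 0 -> (D `&` E) (y i)) ->
  closure (D `&` E) (\sum_i w i *: y i).
Proof.
move=> Ddense cE; apply: convex_comb_ind; first exact: subset_closure.
move=> u z t clu [Dz Ez] t01 B.
(* With the interior, [B] is also a neighbourhood of [v + t *: (z - v)] for [v] near [u], where
   segment-density is applied. *)
move=> /nbhs_interior nB.
have : nbhs u [set v | B^° (v + t *: (z - v))].
  have ct : {for u, continuous (fun v : X => v + t *: (z - v))}.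
    apply: (@continuous2_cvg _ X X X (nbhs u) _ (fun v => v)
      (fun v => t *: (z - v)) +%R).
    - exact: (@add_continuous X (u, _)).
    - exact: cvg_id.
    apply: (@continuous2_cvg _ R^o X X (nbhs u) _ (fun=> t) (fun v => z - v)
      ( *:%R)).
    - exact: (@scale_continuous R X (t, _)).
    - exact: cvg_cst.
    apply: (@continuous2_cvg _ X X X (nbhs u) _ (fun=> z) (fun v => v)
      (fun a b => a - b)).
    - exact: (@sub_continuous X (z, _)).
    - exact: cvg_cst.
    - exact: cvg_id.
  exact: ct nB.
move=> /clu [v [[Dv Ev] /= Bv]].
have := Ddense v z Dv Dz (v + t *: (z - v)).
case/(_ _ B); [by exists t => //; rewrite /= in_itv|exact: Bv|].
move=> x [[[s s01 <-] Dx] Bx]; exists (v + s *: (z - v)).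
split=> //; split=> //.
by apply: convex_set_segment => //; move: s01; rewrite /= in_itv.
Qed.

Lemma open_cover_matching (K D : set X) n (y : 'I_n -> X) (A : 'I_n -> set X) :
  K !=set0 -> compact K -> self_segment_dense D K -> (forall i, D (y i)) ->
  (forall x, K x -> exists i, nbhs x [set u | K u -> A i u]) ->
  exists w : 'I_n -> R, [/\ forall i, 0 <= w i, \sum_i w i = 1,
    D (\sum_i w i *: y i) &
    forall i, w i != 0 -> A i (\sum_i w i *: y i)].
Proof.
move=> [z0 Kz0] cK [DK convK _ Dseg] Dy cover.
have [i0 _] := cover z0 Kz0.
have n0 : (0 < n)%N by apply: leq_ltn_trans (ltn_ord i0).
have [V V0 KV] := lebesgue_cover cK cover.
(* One copy of [W] absorbs the distance from [pt b] to the grid points, the other the move from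
   [pt b] into [D]. *)
have [W W0 WV] := nbhs0_add V0.
have [d d0 Wd] := small_comb y W0.
(* Grid coordinates at distance at most [n] then give weights at distance at most [d]. *)
pose N := (Num.truncn (n%:R / d)).+1.
have N0 : 0 < N%:R :> R by rewrite ltr0n.
have Nd : n%:R / N%:R <= d.
  rewrite ler_pdivrMr // mulrC -ler_pdivrMr // ltW //.
  exact: truncnS_gt.
pose pt (b : 'I_n -> nat) := \sum_i ((b i)%:R / N%:R) *: y i.
have wt0 (b : 'I_n -> nat) i : 0 <= (b i)%:R / N%:R :> R by rewrite divr_ge0.
have wt1 (b : 'I_n -> nat) : (\sum_i b i = N)%N ->
    \sum_i (b i)%:R / N%:R = 1 :> R.
  by move=> bN; rewrite -mulr_suml -natr_sum bN divff // gt_eqF.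
have Kpt (a : grid n N) : K (pt (fun i => val a i)).
  apply: convex_set_comb => //; last by move=> i _; apply: DK.
  by apply: wt1; apply/eqP; case: a.
(* The colour of a grid point is an [i] for which [A i] contains its whole [V]-neighbourhood in
   [K]. *)
have [c hc] := choice (fun a => KV _ (Kpt a)).
have [C [b [bN bC near_b]]] := grid_matching c n0.
pose E := [set x | exists w : 'I_n -> R, [/\ forall i, 0 <= w i,
    \sum_i w i = 1, forall i, i \notin C -> w i = 0 & x = \sum_i w i *: y i]].
have yE i : i \in C -> E (y i).
  move=> iC; exists (fun j => (j == i)%:R); split.
  - by move=> j; rewrite ler0n.
  - by rewrite (bigD1 i) //= eqxx big1 ?addr0 // => j /negPf ->.
  - by move=> j jC; case: eqP => // e; rewrite e iC in jC.
  - rewrite (bigD1 i) //= eqxx scale1r big1 ?addr0 // => j /negPf ->.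
    by rewrite scale0r.
have : closure (D `&` E) (pt b).
  apply: segment_dense_comb => //; [exact: convex_set_hull|exact: wt1|].
  move=> i nz; split=> //; apply: yE; apply: contraNT nz => /bC ->.
  by rewrite mul0r.
move=> /(_ _ (nbhsT (pt b) W0)) [x [[Dx Ex] [v Wv ex]]].
have [w [w0 w1 wC xE]] := Ex; exists w; rewrite -xE; split=> // {w0 w1 xE Ex}.
move=> i wi; have iC : i \in C by apply: contraNT wi => /wC ->.
have [a <- ab] := near_b i iC.
rewrite -ex in Dx *.
have -> : pt b + v = pt (fun i => val a i) + (pt b - pt (fun i => val a i) + v).
  by rewrite addrA subrKC.
apply: hc; last by rewrite addrA subrKC; exact: DK.
apply: WV => //.
have -> : pt b - pt (fun i => val a i) =
    \sum_j (((b j)%:R - (val a j)%:R) / N%:R) *: y j.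
  by rewrite -sumrB; apply: eq_bigr => j _; rewrite mulrBl scalerBl.
apply: Wd => j; rewrite normrM normfV (gtr0_norm N0); apply: le_trans Nd.
rewrite ler_pM2r ?invr_gt0 //.
have /andP [h1 h2] := ab j.
rewrite ler_norml; apply/andP; split; rewrite ?lerBlDl -?natrD.
  by rewrite lerNl opprB lerBlDl -natrD ler_nat.
by rewrite ler_nat.
Qed.

End Topology.

(** Compactness is applied along the filter of finite lists ordered by inclusion, so the sets [A i]
    need not be open. *)
Lemma compact_finite_subcover (T : topologicalType) (I : eqType) (K : set T)
    (D : set I) (A : I -> set T) : compact K ->
  (forall x, K x -> exists2 i, D i & nbhs x (A i)) ->
  exists2 s : seq I, (forall i, i \in s -> D i) &
    forall x, K x -> exists2 i, i \in s & A i x.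
Proof.
move=> /compact_near_coveringP cK cover.
pose F := filter_from [set s : seq I | forall i, i \in s -> D i]
  (fun s => [set s' : seq I | {subset s <= s'}]).
have FF : Filter F.
  apply: filter_from_filter => [|s t /= sD tD]; first by exists [::].
  exists (s ++ t) => [i|s' /= h]; first by rewrite mem_cat => /orP [/sD|/tD].
  by split=> i ii; apply: h; rewrite mem_cat ii ?orbT.
pose P (s : seq I) x := exists2 i, i \in s & A i x.
have [x Kx|s sD h] := cK _ F P FF.
  have [i Di nA] := cover x Kx.
  exists (A i, [set s : seq I | i \in s]) => /= [|[u s] [/= Au is_]];
    last by exists i.
  split=> //; exists [:: i] => [j|s /= h]; first by rewrite inE => /eqP ->.
  by apply: h; rewrite inE.
by exists s => // x Kx; exact: h.
Qed.

(** * Cones and semicontinuity *)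

Section Cones.
Context {R : realType} {Z : tvsType R} (C : set Z).
Hypotheses (C_convex : convex_cone C) (C_pointed : pointed_cone C).

Lemma pointed_cone0 : C 0.
Proof. by have /seteqP [_ /(_ 0 erefl) []] := C_pointed.2. Qed.

Lemma pointed_cone_anti z : C z -> C (- z) -> z = 0.
Proof.
move=> Cz CNz; have /seteqP [+ _] := C_pointed.2; apply.
by split=> //; exists (- z); rewrite ?opprK.
Qed.

Lemma convex_cone_add a b : C a -> C b -> C (a + b).
Proof.
move=> Ca Cb; have /seteqP [+ _] := C_convex.2; apply.
by exists a => //; exists b.
Qed.

(** Otherwise, for [w j != 0], adding the other terms to minus the sum puts [- (w j *: c j)] in [C],
    and pointedness gives [c j = 0]. *)
Lemma pointed_cone_comb n (w : 'I_n -> R) (c : 'I_n -> Z) :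
  (forall i, 0 <= w i) -> \sum_i w i = 1 ->
  (forall i, w i != 0 -> (C `\ 0) (c i)) -> ~ C (- \sum_i w i *: c i).
Proof.
move=> w0 w1 cC CN.
have Cwc i : C (w i *: c i).
  have [->|wi] := eqVneq (w i) 0.
    by rewrite scale0r; exact: pointed_cone0.
  by have [Cc _] := cC i wi; exact: C_convex.1.
have [j wj] : exists j, w j != 0.
  apply: contrapT => /forallNP h; move: w1; rewrite big1 => [/esym/eqP|i _].
    by rewrite oner_eq0.
  by have /negP := h i; rewrite negbK => /eqP.
have [_ cj0] := cC j wj.
suff /eqP : w j *: c j = 0.
  by rewrite scaler_eq0 (negPf wj) => /eqP.
apply: pointed_cone_anti => //.
have -> : - (w j *: c j) = - (\sum_i w i *: c i) + \sum_(i | i != j) w i *: c i.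
  by rewrite (bigD1 j) //= opprD subrK.
apply: convex_cone_add => //; elim/big_ind: _ => //.
  exact: pointed_cone0.
exact: convex_cone_add.
Qed.

End Cones.

(** The choice [k = - g x] turns [g x + k - c] into [- c]. *)
Lemma strongly_usc_neg_nbhs (R : realType) (X Z : tvsType R) (C : set Z)
    (K : set X) (g : X -> Z) (x : X) :
  strongly_usc_at C K g x -> (-%R @` (C `\ 0)) (g x) ->
  nbhs x [set u | K u -> (-%R @` (C `\ 0)) (g u)].
Proof.
move=> usc [k Ck gx]; have [U nU hU] := usc k Ck.
apply: filterS nU => u Uu Ku; have [c Cc <-] := hU u (conj Uu Ku).
by exists c => //; rewrite -gx addNr add0r.
Qed.

(** * Existence of a solution of the vector variational inequality *)

Theorem theorem5p5 (R : realType) (X Z : tvsType R)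
    (hX : hausdorff_space X) (hZ : hausdorff_space Z)
    (C : set Z) (C_convex : convex_cone C) (C_pointed : pointed_cone C)
    (K : set X) (K0 : K !=set0) (K_convex : convex_set K) (K_compact : compact K)
    (D : set X) (DK : D `<=` K) (D_dense : self_segment_dense D K)
    (F : X -> {linear_continuous X -> Z})
    (h1 : forall y, D y -> strongly_usc_on C K (fun x => F y (y - x)) K)
    (h2 : forall x, K x ->
      strongly_usc_on C K (fun y => F y (y - x)) (K `\` D))
    (h3 : forall x, D x -> C_convex_on C D (fun y => F y (y - x))) :
  exists2 x0, K x0 &
    forall y, K y -> ~ (-%R @` (C `\ 0)) (F y (y - x0)).
Proof.
pose A y x := (-%R @` (C `\ 0)) (F y (y - x)).
apply: contrapT => no_sol.
have cover x : K x -> exists2 y, D y & A y x.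
  move=> Kx; apply: contrapT => noD; apply: no_sol; exists x => // y Ky Ayx.
  have [Dy|nDy] := pselect (D y); first by apply: noD; exists y.
  have [_ _ /(_ y Ky) cly _] := D_dense.
  have := strongly_usc_neg_nbhs (h2 x Kx y (conj Ky nDy)) Ayx.
  by move=> /cly [u [Du /(_ (DK _ Du)) Aux]]; apply: noD; exists u.
have oA y x : D y -> K x -> A y x -> nbhs x [set u | K u -> A y u].
  by move=> Dy Kx; exact: (strongly_usc_neg_nbhs (h1 y Dy x Kx)).
have [Y YD KY] : exists2 Y : seq X, (forall y, y \in Y -> D y) &
    forall x, K x -> exists2 y, y \in Y & nbhs x [set u | K u -> A y u].
  apply: compact_finite_subcover K_compact _ => x Kx.
  have [y Dy Ay] := cover x Kx; exists y => //.
  (* Passing to interiors keeps, in the finite cover, a relative neighbourhood of each point, as the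
     matching requires. *)
  exact/nbhs_interior/oA.
have [z0 _] := K0.
pose y (i : 'I_(size Y)) := nth z0 Y i.
have Dy i : D (y i).
  by apply: YD; rewrite /y mem_nth.
have [|w [w0 w1 Dx Aw]] :=
    open_cover_matching (A := fun i => A (y i)) K0 K_compact D_dense Dy.
  move=> x Kx; have [v vY hv] := KY x Kx.
  have iY : (index v Y < size Y)%N by rewrite index_mem.
  by exists (Ordinal iY); rewrite /y /= nth_index.
set x := \sum_i w i *: y i in Dx Aw.
(* The value 0 chosen at indices of weight 0 is a dummy. *)
have /choice [c hc] i : exists k : Z, w i != 0 ->
    (C `\ 0) k /\ - k = F (y i) (y i - x).
  have [_|wi] := eqVneq (w i) 0; first by exists 0.
  by have [k Ck e] := Aw i wi; exists k.
apply: (pointed_cone_comb C_convex C_pointed w0 w1) => [i /hc [h _]|].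
  exact: h.
(* The mapping is based at the combination [x] itself, where its value is [F x (x - x) = 0]; hence
   the weighted sum of the [F (y i) (y i - x)] lies in [C]. *)
have := h3 x Dx (size Y) y w Dy w0 w1 Dx.
rewrite /cone_le /= subrr linear0 subr0.
congr C; rewrite -[RHS]sumrN; apply: eq_bigr => i _.
have [->|/hc [_ <-]] := eqVneq (w i) 0; first by rewrite !scale0r oppr0.
by rewrite scalerN.
Qed.
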